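(* Let $H_1,H_2,K_1,K_2$ be Hilbert spaces, and let $T_{1}:D(T_{1})\subset H_{1}\to K_{1}$ and $T_{2}:D(T_{2})\subset H_{2}\to K_{2}$ be two densely defined closed operators with closed ranges $R(T_{1})$ and $R(T_{2})$. Then $|(T_{1}\bigoplus T_{2})^{\dagger}|=|T_{1}^{\dagger}|\bigoplus|T_{2}^{\dagger}|$.
   Context: Operators are linear, defined on a linear subspace (the domain), and closed means the graph is closed. $N(T)$, $R(T)$ are null space and range, and $C(T)=D(T)\cap N(T)^{\perp}$. The Moore-Penrose inverse of a closed operator $T:D(T)\subset H\to K$ is the linear operator $T^{\dagger}:D(T^{\dagger})=R(T)\oplus^{\perp}R(T)^{\perp}\subset K\to H$ (orthogonal direct sum) with $T^{\dagger}y=(T|_{C(T)})^{-1}y$ for $y\in R(T)$ and $T^{\dagger}y=0$ for $y\in R(T)^{\perp}$. $H\bigoplus K$ denotes the Hilbert space of pairs $(h,k)$ with inner product $\langle(h_1,k_1),(h_2,k_2)\rangle=\langle h_1,h_2\rangle+\langle k_1,k_2\rangle$. The direct sum of operators is $(T_{1}\bigoplus T_{2})(h_{1},h_{2})=(T_{1}h_{1},T_{2}h_{2})$ on $D(T_1)\bigoplus D(T_2)$. For a densely defined closed operator $A$, $|A|=(A^{*}A)^{1/2}$ (positive square root). *)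

(* Defs.v *)
From HB Require Import structures.
From mathcomp Require Import all_boot all_order all_algebra.
From mathcomp Require Import ring complex.
From mathcomp Require Import all_classical all_reals all_analysis.

Set Implicit Arguments.
Unset Strict Implicit.
Unset Printing Implicit Defensive.

Import Order.TTheory GRing.Theory Num.Theory.
Import numFieldNormedType.Exports.

Local Open Scope classical_set_scope.
Local Open Scope ring_scope.

Reserved Notation "S =op T" (at level 70, no associativity).

(* Complex Hilbert spaces. The inner product is linear in its first argument
   and conjugate-linear in the second one. *)
HB.mixin Record CompleteNormedModule_isHilbert (R : realType) H
    of CompleteNormedModule R[i] H := {
  inner : {dot H for (Num.conj : R[i] -> R[i])} ;
  innerE : forall x : H, inner x x = `|x| ^+ 2
}.

#[short(type="hilbertType")]
HB.structure Definition Hilbert (R : realType) :=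
  {H of CompleteNormedModule R[i] H & CompleteNormedModule_isHilbert R H}.

Notation "''[' x , y ]" := (inner x%R y%R) : ring_scope.

(* An alias of the product type is needed because [H * K] canonically carries
   the sup norm, which does not come from an inner product. *)
Definition hsum (R : realType) (H K : hilbertType R) : Type := (H * K)%type.

Section hsum_instances.
Context {R : realType} {H K : hilbertType R}.
Local Notation HK := (hsum H K).

HB.instance Definition _ := GRing.Lmodule.copy HK (H * K)%type.

Definition hsum_inner (u v : HK) : R[i] := '[u.1, v.1] + '[u.2, v.2].

Definition hsum_norm (u : HK) : R[i] := sqrtC (`|u.1| ^+ 2 + `|u.2| ^+ 2).

Let hsum_innerl (v : HK) : linear_for *%R (hsum_inner ^~ v).
Proof.
move=> a x y; rewrite /hsum_inner /= !linearPl /=.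
by rewrite mulrDr addrACA.
Qed.

Let hsum_innerr (u : HK) : linear_for (Num.conj \; *%R) (hsum_inner u).
Proof.
move=> a x y; rewrite /hsum_inner /= !linearPr /=.
by rewrite mulrDr addrACA.
Qed.

HB.instance Definition _ := bilinear_isBilinear.Build R[i] HK HK R[i]
  *%R (Num.conj \; *%R) hsum_inner (hsum_innerl, hsum_innerr).

Let hsum_hermitian (u v : HK) :
  hsum_inner u v = (-1) ^+ false * Num.conj (hsum_inner v u).
Proof.
rewrite expr0 mul1r /hsum_inner rmorphD /=.
by congr (_ + _); rewrite hermC expr0 mul1r.
Qed.

HB.instance Definition _ := isHermitianSesquilinear.Build R[i] HK false
  Num.conj hsum_inner hsum_hermitian.

Let hsum_inner_gt0 (u : HK) : u != 0 -> 0 < hsum_inner u u.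
Proof.
case: u => x y xy0; rewrite /hsum_inner /= !innerE.
have [x0|x0] := eqVneq x 0.
  rewrite x0 normr0 expr0n add0r exprn_gt0// normr_gt0.
  by apply: contra xy0 => /eqP ->; rewrite x0.
by rewrite ltr_wpDr// ?exprn_ge0// exprn_gt0// normr_gt0.
Qed.

HB.instance Definition _ :=
  isDotProduct.Build R[i] HK hsum_inner hsum_inner_gt0.

Let hsum_norm_ge0 (u : HK) : 0 <= hsum_norm u.
Proof. by rewrite sqrtC_ge0 addr_ge0// exprn_ge0. Qed.

Let hsum_normD (u v : HK) : hsum_norm (u + v) <= hsum_norm u + hsum_norm v.
Proof.
have sq_ge0 (z : HK) : 0 <= `|z.1| ^+ 2 + `|z.2| ^+ 2.
  by rewrite addr_ge0// exprn_ge0.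
rewrite -(ler_pXn2r (ltn0Sn 1)) ?nnegrE ?addr_ge0//.
rewrite sqrrD /hsum_norm !sqrtCK -sqrtCM ?nnegrE//.
set a := `|u.1|; set b := `|v.1|; set c := `|u.2|; set d := `|v.2|.
have [a0 b0 c0 d0] : [/\ 0 <= a, 0 <= b, 0 <= c & 0 <= d].
  by split; exact: normr_ge0.
have abcd : a * b + c * d <=
    sqrtC ((a ^+ 2 + c ^+ 2) * (b ^+ 2 + d ^+ 2)).
  have p0 : 0 <= a * b + c * d by rewrite addr_ge0// mulr_ge0.
  have q0 : 0 <= (a ^+ 2 + c ^+ 2) * (b ^+ 2 + d ^+ 2).
    exact: mulr_ge0 (sq_ge0 u) (sq_ge0 v).
  rewrite -[leLHS]sqrCK// ler_sqrtC ?nnegrE ?exprn_ge0//.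
  rewrite -subr_ge0.
  have -> : (a ^+ 2 + c ^+ 2) * (b ^+ 2 + d ^+ 2) - (a * b + c * d) ^+ 2 =
      (a * d - c * b) ^+ 2 by ring.
  by rewrite -realEsqr realB// realM// ger0_real.
apply: (@le_trans _ _ ((a + b) ^+ 2 + (c + d) ^+ 2)).
  by apply: lerD; rewrite ler_pXn2r ?nnegrE ?addr_ge0// ler_normD.
have -> : (a + b) ^+ 2 + (c + d) ^+ 2 =
  a ^+ 2 + c ^+ 2 + (a * b + c * d) *+ 2 + (b ^+ 2 + d ^+ 2) by ring.
by rewrite lerD2r lerD2l lerMn2r.
Qed.

Let hsum_normZ (a : R[i]) (u : HK) : hsum_norm (a *: u) = `|a| * hsum_norm u.
Proof.
rewrite /hsum_norm /= !normrZ !exprMn -mulrDr sqrtCM ?nnegrE ?exprn_ge0//.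
by rewrite sqrCK.
Qed.

Let hsum_norm0_eq0 (u : HK) : hsum_norm u = 0 -> u = 0.
Proof.
move/eqP; rewrite sqrtC_eq0 paddr_eq0 ?exprn_ge0// !sqrf_eq0 !normr_eq0.
by case: u => x y /= /andP[/eqP -> /eqP ->].
Qed.

HB.instance Definition _ := Lmodule_isNormed.Build R[i] HK
  hsum_normD hsum_normZ hsum_norm0_eq0.

Let hsum_normE (u : HK) : `|u| = hsum_norm u. Proof. by []. Qed.

Let hsum_norm1 (u : HK) : `|u.1| <= `|u|.
Proof.
rewrite hsum_normE -[leLHS]sqrCK// ler_sqrtC ?nnegrE ?addr_ge0 ?exprn_ge0//.
by rewrite lerDl exprn_ge0.
Qed.

Let hsum_norm2 (u : HK) : `|u.2| <= `|u|.
Proof.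
rewrite hsum_normE -[leLHS]sqrCK// ler_sqrtC ?nnegrE ?addr_ge0 ?exprn_ge0//.
by rewrite lerDr exprn_ge0.
Qed.

Let hsum_norm_le (u : HK) : `|u| <= `|u.1| + `|u.2|.
Proof.
rewrite hsum_normE -[leRHS]sqrCK ?addr_ge0//.
rewrite ler_sqrtC ?nnegrE ?exprn_ge0 ?addr_ge0 ?exprn_ge0//.
by rewrite sqrrD addrAC lerDl mulrn_wge0// mulr_ge0.
Qed.

Let hsum_complete (F : set_system HK) : ProperFilter F -> cauchy F -> cvg F.
Proof.
move=> FF /cauchyP Fc.
have c1 : cvg ((fst : HK -> H) @ F).
  apply: cauchy_cvg; apply: cauchy_exP => e e0.
  have [u Fu] := Fc e e0; exists u.1.
  have sub : ball u e `<=` fst @^-1` ball u.1 e.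
    move=> v; rewrite -!ball_normE /=.
    by apply: le_lt_trans; exact: (hsum_norm1 (u - v)).
  exact: filterS sub Fu.
have c2 : cvg ((snd : HK -> K) @ F).
  apply: cauchy_cvg; apply: cauchy_exP => e e0.
  have [u Fu] := Fc e e0; exists u.2.
  have sub : ball u e `<=` snd @^-1` ball u.2 e.
    move=> v; rewrite -!ball_normE /=.
    by apply: le_lt_trans; exact: (hsum_norm2 (u - v)).
  exact: filterS sub Fu.
have /cvg_ex[x Fx] := c1; have /cvg_ex[y Fy] := c2.
apply/cvg_ex; exists ((x, y) : HK); apply/cvgrPdist_lt => e e0.
near=> u; apply: le_lt_trans (hsum_norm_le _) _.
rewrite (splitr e) ltrD//=.
  by near: u; move/cvgrPdist_lt : Fx; apply; rewrite divr_gt0.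
by near: u; move/cvgrPdist_lt : Fy; apply; rewrite divr_gt0.
Unshelve. all: by end_near. Qed.

HB.instance Definition _ := Uniform_isComplete.Build HK hsum_complete.

Let hsum_innerE (u : HK) : hsum_inner u u = `|u| ^+ 2.
Proof. by rewrite hsum_normE sqrtCK /hsum_inner !innerE. Qed.

HB.instance Definition _ :=
  CompleteNormedModule_isHilbert.Build R HK hsum_innerE.

End hsum_instances.

(* A partial function [dom -> K]; the values of [op_app] outside [dom] are
   irrelevant, so operators are compared with [op_eq] and not with [=]. *)
Record operator (R : realType) (H K : hilbertType R) := Operator {
  dom : set H ;
  op_app :> H -> K
}.

Section operators.
Context {R : realType}.
Implicit Types H K L : hilbertType R.

HB.instance Definition _ H K := gen_eqMixin (operator H K).
HB.instance Definition _ H K := gen_choiceMixin (operator H K).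

Definition op_eq H K (S T : operator H K) :=
  dom S = dom T /\ forall x, dom S x -> S x = T x.

Definition linear_op H K (T : operator H K) :=
  [/\ dom T 0,
      forall (a : R[i]) x y, dom T x -> dom T y -> dom T (a *: x + y) &
      forall (a : R[i]) x y, dom T x -> dom T y ->
        T (a *: x + y) = a *: T x + T y].

Definition graph H K (T : operator H K) : set (H * K) :=
  [set u | dom T u.1 /\ u.2 = T u.1].

Definition closed_op H K (T : operator H K) :=
  linear_op T /\ closed (graph T).

Definition densely_defined H K (T : operator H K) := dense (dom T).

Definition nullspace H K (T : operator H K) : set H :=
  [set x | dom T x /\ T x = 0].

Definition ran H K (T : operator H K) : set K := T @` dom T.

Definition orthocomp H (A : set H) : set H :=
  [set x | forall y, A y -> '[x, y] = 0].

Definition carrier H K (T : operator H K) : set H :=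
  dom T `&` orthocomp (nullspace T).

Definition op_restrict H K (T : operator H K) (A : set H) : operator H K :=
  Operator (dom T `&` A) T.

(* Meaningful when [T] is injective on its domain. *)
Definition op_inv H K (T : operator H K) : operator K H :=
  Operator (ran T) (fun y => xget 0 [set x | dom T x /\ T x = y]).

Definition op_comp H K L (S : operator K L) (T : operator H K) :
    operator H L :=
  Operator [set x | dom T x /\ dom S (T x)] (fun x => S (T x)).

Definition op_sum H1 H2 K1 K2 (T1 : operator H1 K1) (T2 : operator H2 K2) :
    operator (hsum H1 H2) (hsum K1 K2) :=
  Operator [set h : hsum H1 H2 | dom T1 h.1 /\ dom T2 h.2]
    (fun h : hsum H1 H2 => (T1 h.1, T2 h.2) : hsum K1 K2).

(* Meaningful when [T] is densely defined: the vector [z] is then unique. *)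
Definition adjoint H K (T : operator H K) : operator K H :=
  let is_adj y z := forall x, dom T x -> '[T x, y] = '[x, z] in
  Operator [set y | exists z, is_adj y z] (fun y => xget 0 (is_adj y)).

(* [y] decomposes uniquely as [y1 + y2] with [y1] in the range of [T] and
   [y2] orthogonal to it; the value at [y] is [(T|_C(T))^-1 y1]. *)
Definition moore_penrose H K (T : operator H K) : operator K H :=
  Operator
    [set y | exists y1 y2,
       [/\ ran T y1, orthocomp (ran T) y2 & y = y1 + y2]]
    (fun y => xget 0 [set x | exists y1 y2,
       [/\ ran T y1, orthocomp (ran T) y2, y = y1 + y2 &
           x = op_inv (op_restrict T (carrier T)) y1]]).

Definition selfadjoint H (S : operator H H) :=
  densely_defined S /\ op_eq (adjoint S) S.

(* The order of [R[i]] is such that [0 <= z] means that [z] is real and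
   nonnegative. *)
Definition positive_op H (S : operator H H) :=
  forall x, dom S x -> 0 <= '[S x, x].

Definition is_sqrt H (A S : operator H H) :=
  [/\ linear_op S, selfadjoint S, positive_op S & op_eq (op_comp S S) A].

(* A positive self-adjoint operator has exactly one positive self-adjoint
   square root (up to [op_eq]), so that the zero operator below is a junk value
   that only matters for other operators. *)
Definition op_sqrt H (A : operator H H) : operator H H :=
  xget (Operator setT (fun=> 0)) [set S | is_sqrt A S].

Definition op_abs H K (T : operator H K) : operator H H :=
  op_sqrt (op_comp (adjoint T) T).

End operators.

Notation "S =op T" := (op_eq S T).

(* Main.v *)
(* The Moore-Penrose inverse B of a closed operator with closed range is
   everywhere defined, by the projection theorem. Its adjoint has dense domain
   and, by the uniform boundedness principle, is bounded and everywhere defined,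
   so that B^* B is a bounded positive operator. The square root of a bounded
   positive operator exists (as a limit of polynomials) and is unique among all
   positive self-adjoint operators. The Moore-Penrose inverse of a direct sum is
   the direct sum of the Moore-Penrose inverses, and a direct sum of positive
   square roots is a positive square root, so uniqueness concludes. *)
Require Import Defs.
From HB Require Import structures.
From mathcomp Require Import all_boot all_order all_algebra.
From mathcomp Require Import ring lra complex.
From mathcomp Require Import all_classical all_reals all_analysis.

Set Implicit Arguments.
Unset Strict Implicit.
Unset Printing Implicit Defensive.

Import Order.TTheory GRing.Theory Num.Theory.
Import numFieldNormedType.Exports.

Local Open Scope classical_set_scope.
Local Open Scope complex_scope.
Local Open Scope ring_scope.

(** * The real part of the inner product *)

Section RealInnerProduct.
Context {R : realType} {H : hilbertType R}.
Implicit Types (x y z : H) (a : R).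

(** Values in the ordered field [R] make [lra], [nra] and real limits available; [inner_rip]
    recovers the complex product. *)
Definition rip x y : R := complex.Re '[x, y].

Lemma ripDl x y z : rip (x + y) z = rip x z + rip y z.
Proof. by rewrite /rip linearDl /= raddfD. Qed.

Lemma ripDr x y z : rip x (y + z) = rip x y + rip x z.
Proof. by rewrite /rip linearDr /= raddfD. Qed.

Lemma ripNl x y : rip (- x) y = - rip x y.
Proof. by rewrite /rip linearNl /= raddfN. Qed.

Lemma ripNr x y : rip x (- y) = - rip x y.
Proof. by rewrite /rip linearNr /= raddfN. Qed.

Lemma ripBl x y z : rip (x - y) z = rip x z - rip y z.
Proof. by rewrite ripDl ripNl. Qed.

Lemma ripBr x y z : rip x (y - z) = rip x y - rip x z.
Proof. by rewrite ripDr ripNr. Qed.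

Lemma rip0l y : rip 0 y = 0. Proof. by rewrite -(subrr 0) ripBl subrr. Qed.

Lemma rip0r x : rip x 0 = 0. Proof. by rewrite -(subrr 0) ripBr subrr. Qed.

Lemma ripZl a x y : rip (a%:C *: x) y = a * rip x y.
Proof. by rewrite /rip linearZl_LR /=; case: '[x, y] => u v /=; ring. Qed.

Lemma innerC x y : '[x, y] = '[y, x]^*.
Proof. by rewrite hermC expr0 mul1r. Qed.

Lemma ripC x y : rip x y = rip y x.
Proof. by rewrite /rip innerC; case: '[y, x]. Qed.

Lemma ripZr a x y : rip x (a%:C *: y) = a * rip x y.
Proof. by rewrite ripC ripZl ripC. Qed.

Lemma inner_rip x y : '[x, y] = Complex (rip x y) (rip x ('i%C *: y)).
Proof.
rewrite /rip linearZr_LR /=; case: '[x, y] => u v /=.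
by congr (_ +i* _); ring.
Qed.

Lemma rip_ge0 x : 0 <= rip x x.
Proof. by have := dnorm_ge0 inner x; rewrite lecE => /andP[]. Qed.

Lemma innerxx x : '[x, x] = (rip x x)%:C.
Proof.
have := dnorm_ge0 (inner (s := H)) x; rewrite lecE => /andP[/eqP h _].
by rewrite /rip; case: '[x, x] h => u v /= ->.
Qed.

Lemma rip_eq0 x : (rip x x == 0) = (x == 0).
Proof.
rewrite -(dnorm_eq0 inner) innerxx; apply/eqP/eqP => [->//|].
by move/(congr1 (@complex.Re R)).
Qed.

Lemma rip_nondeg x : (forall y, rip x y = 0) -> x = 0.
Proof. by move=> h; apply/eqP; rewrite -rip_eq0 h. Qed.

Lemma rip_ext x y : (forall z, rip x z = rip y z) -> x = y.
Proof.
move=> h; apply/eqP; rewrite -subr_eq0; apply/eqP/rip_nondeg => z.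
by rewrite ripBl h subrr.
Qed.

Definition rn x : R := Num.sqrt (rip x x).

Lemma rn_ge0 x : 0 <= rn x. Proof. exact: sqrtr_ge0. Qed.

Lemma sqr_rn x : rn x ^+ 2 = rip x x. Proof. by rewrite sqr_sqrtr ?rip_ge0. Qed.

Lemma normE x : `|x| = (rn x)%:C.
Proof.
apply/eqP; rewrite -(eqrXn2 (ltn0Sn 1)) ?normr_ge0 ?ler0c ?rn_ge0//.
by rewrite -innerE innerxx -sqr_rn rmorphXn.
Qed.

Lemma rnD x y : rn (x + y) <= rn x + rn y.
Proof. by have := ler_normD x y; rewrite !normE -rmorphD /= lecR. Qed.

Lemma rn0 : rn 0 = 0. Proof. by rewrite /rn rip0l sqrtr0. Qed.

Lemma rnN x : rn (- x) = rn x.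
Proof. by rewrite /rn ripNl ripNr opprK. Qed.

Lemma rnB x y : rn (x - y) = rn (y - x).
Proof. by rewrite -rnN opprB. Qed.

Lemma rnZc (a : R[i]) x : rn (a *: x) = Normc.normc a * rn x.
Proof.
apply: (@complexI R); rewrite rmorphM /= -!normE normrZ.
by rewrite normc_def; case: a.
Qed.

Lemma rnZ a x : rn (a%:C *: x) = `|a| * rn x.
Proof. by rewrite rnZc /= expr0n addr0 sqrtr_sqr. Qed.

Lemma rn_eq0 x : (rn x == 0) = (x == 0).
Proof. by rewrite -rip_eq0 -sqr_rn sqrf_eq0. Qed.

Lemma rn_le x a : 0 <= a -> rip x x <= a ^+ 2 -> rn x <= a.
Proof. by move=> a0; rewrite -sqr_rn ler_pXn2r ?nnegrE ?rn_ge0. Qed.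

Lemma rip_le x y : rip x y <= rn x * rn y.
Proof.
have [->|y0] := eqVneq y 0; first by rewrite rip0r rn0 mulr0.
have yy : 0 < rip y y by rewrite lt_def rip_eq0 y0 rip_ge0.
have [h|h] := lerP (rip x y) 0.
  by rewrite (le_trans h)// mulr_ge0 ?rn_ge0.
rewrite -(ler_pXn2r (ltn0Sn 1)) ?nnegrE ?mulr_ge0 ?rn_ge0 ?(ltW h)//.
rewrite exprMn !sqr_rn.
(* With the names set below, the squared norm of [q x - r y] is [q (p q - r^2)]. *)
have := rip_ge0 ((rip y y)%:C *: x - (rip x y)%:C *: y).
rewrite ripBl !ripBr !ripZl !ripZr (ripC y x).
set p := rip x x; set q := rip y y; set r := rip x y => k.
have : 0 <= q * (p * q - r ^+ 2) by rewrite (le_trans k)//; nra.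
by rewrite pmulr_rge0// subr_ge0.
Qed.

Lemma abs_rip_le x y : `|rip x y| <= rn x * rn y.
Proof. by rewrite ler_norml rip_le andbT lerNl -ripNl -(rnN x) rip_le. Qed.

End RealInnerProduct.

Lemma eq_inner_rip {R : realType} {H K : hilbertType R} (a b : H) (c d : K) :
  rip a b = rip c d -> rip a ('i%C *: b) = rip c ('i%C *: d) ->
  '[a, b] = '[c, d].
Proof. by rewrite !inner_rip => -> ->. Qed.

(** * Convergence of sequences *)

Section Convergence.
Context {R : realType} {H : hilbertType R}.
Implicit Types (u v : nat -> H) (x y l m : H).

Definition hcvg u l := (fun n => rn (u n - l)) @ \oo --> (0 : R).

Lemma hcvg_le u l (e : nat -> R) :
  (forall n, rn (u n - l) <= e n) -> e @ \oo --> (0 : R) -> hcvg u l.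
Proof.
move=> h e0; apply: (squeeze_cvgr _ (cvg_cst _) e0).
by near=> n; rewrite rn_ge0 h.
Unshelve. all: by end_near. Qed.

Lemma hcvg_cst l : hcvg (fun=> l) l.
Proof.
apply: (@hcvg_le _ _ (fun=> 0)) => [n|]; first by rewrite subrr rn0.
exact: cvg_cst.
Qed.

Lemma hcvg_lin (a : R[i]) u v l m : hcvg u l -> hcvg v m ->
  hcvg (fun n => a *: u n + v n) (a *: l + m).
Proof.
move=> ul vm; apply: (@hcvg_le _ _
  (fun n => Normc.normc a * rn (u n - l) + rn (v n - m))) => [n|].
  by rewrite opprD addrACA -scalerBr (le_trans (rnD _ _))// rnZc.
rewrite [X in _ --> X](_ : _ = Normc.normc a * 0 + 0).
  by apply: cvgD => //; apply: cvgMr.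
by rewrite mulr0 addr0.
Qed.

Lemma hcvgZ (a : R[i]) u l : hcvg u l -> hcvg (fun n => a *: u n) (a *: l).
Proof.
move=> ul; have := hcvg_lin a ul (hcvg_cst 0); rewrite addr0.
by under eq_fun do rewrite addr0.
Qed.

Lemma hcvgD u v l m : hcvg u l -> hcvg v m -> hcvg (fun n => u n + v n) (l + m).
Proof.
move=> ul vm; have := hcvg_lin 1 ul vm; rewrite scale1r.
by under eq_fun do rewrite scale1r.
Qed.

Lemma hcvg_shift u l : hcvg u l -> hcvg (fun n => u n.+1) l.
Proof. by move=> ul; rewrite /hcvg (cvg_shiftS (fun n => rn (u n - l))). Qed.


Lemma cvg0_mulr (e : nat -> R) (a : R) :
  e @ \oo --> (0 : R) -> (fun n => e n * a) @ \oo --> (0 : R).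
Proof. by move=> e0; rewrite -[X in _ --> X](mul0r a); exact: cvgMl. Qed.

Lemma cvg_dist_le (s : nat -> R) (a : R) (e : nat -> R) :
  (forall n, `|s n - a| <= e n) -> e @ \oo --> (0 : R) -> s @ \oo --> a.
Proof.
move=> h e0; apply/cvgrPdist_lt => d d0.
move/cvgr0Pnorm_lt : e0 => /(_ d d0); apply: filterS => n.
rewrite distrC => k.
by rewrite (le_lt_trans (h n))// (le_lt_trans (ler_norm _)).
Qed.

Lemma hcvg_rip u l y : hcvg u l -> (fun n => rip (u n) y) @ \oo --> rip l y.
Proof.
move=> ul; apply: (@cvg_dist_le _ _ (fun n => rn (u n - l) * rn y)) => [n|].
  by rewrite -ripBl abs_rip_le.
exact: cvg0_mulr.
Qed.

Lemma hcvg_ext u v l : u =1 v -> hcvg u l -> hcvg v l.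
Proof. by move=> /funext ->. Qed.

Lemma hcvg_unique u l m : hcvg u l -> hcvg u m -> l = m.
Proof.
move=> ul um; apply: rip_ext => z.
by apply: (cvg_unique _ (hcvg_rip (y := z) ul) (hcvg_rip um)).
Qed.

Lemma hcvg_rn_le u l a : hcvg u l -> (forall n, rn (u n) <= a) -> rn l <= a.
Proof.
move=> ul ua; rewrite -[leRHS]addr0.
have h : (fun n => a + rn (u n - l)) @ \oo --> a + 0.
  by apply: cvgD ul; exact: cvg_cst.
apply: (cvgr_to_ge h); apply: nearW => n.
by rewrite -[X in rn X <= _](subrKC (u n)) (le_trans (rnD _ _))// lerD// rnB.
Qed.

Lemma hcvgE u l : hcvg u l <-> u @ \oo --> l.
Proof.
split=> [ul|ul].
  apply/cvgrPdist_lt => -[e e'] /= ; rewrite ltcE /= => /andP[/eqP -> e0].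
  move/cvgr0Pnorm_lt : ul => /(_ e e0); apply: filterS => n.
  by rewrite (ger0_norm (rn_ge0 _)) normE ltcR rnB.
apply/cvgr0Pnorm_lt => e e0; move/cvgrPdist_lt : ul => /(_ e%:C).
rewrite ltcR => /(_ e0).
by apply: filterS => n; rewrite (ger0_norm (rn_ge0 _)) normE ltcR rnB.
Qed.

Lemma hcvg_closed (A : set H) u l : closed A -> (forall n, A (u n)) ->
  hcvg u l -> A l.
Proof.
move=> cA uA /hcvgE ul; apply: (closed_cvg A cA _ _ ul).
exact: nearW.
Qed.

Lemma hcvg_cauchy u :
  (forall d : R, 0 < d ->
    exists N, forall n, (N <= n)%N -> rn (u n - u N) < d) ->
  exists l, hcvg u l.
Proof.
move=> uC; have : cvg (u @ \oo).
  apply: cauchy_cvg; apply: cauchy_exP => -[d d'].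
  rewrite ltcE /= => /andP[/eqP -> d0].
  have [N uN] := uC d d0; exists (u N); exists N => // n /= Nn.
  by rewrite -ball_normE /= normE ltcR rnB; exact: uN.
by move=> /cvg_ex[l /hcvgE ul]; exists l.
Qed.

Lemma hcomplete u (e : nat -> R) : e @ \oo --> (0 : R) ->
  (forall n k, (n <= k)%N -> rn (u k - u n) <= e n) ->
  exists2 l, hcvg u l & forall n, rn (l - u n) <= e n.
Proof.
move=> e0 ue; have [d d0|l ul] := @hcvg_cauchy u.
  move/cvgr0Pnorm_lt : e0 => /(_ d d0) [N _ Nd]; exists N => n Nn.
  apply: le_lt_trans (ue _ _ Nn) _; apply: le_lt_trans (ler_norm _) _.
  exact: Nd N (leqnn _).
exists l => // n.
have h : hcvg (fun k => u (k + n)%N - u n) (l - u n); last first.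
  by apply: (hcvg_rn_le h) => k; exact/ue/leq_addl.
apply: (@hcvg_le _ _ (fun k => rn (u (k + n)%N - l))) => [m|].
  by rewrite opprB addrA subrK.
by rewrite (cvg_shiftn n (fun k => rn (u k - l))).
Qed.

End Convergence.

Lemma hcvg_rip_eq {R : realType} {H K : hilbertType R}
    (u : nat -> H) (v : nat -> K) l m y z : hcvg u l -> hcvg v m ->
  (forall n, rip (u n) y = rip (v n) z) -> rip l y = rip m z.
Proof.
move=> ul vm /funext e; have := hcvg_rip (y := y) ul.
by rewrite e => h; exact: (cvg_unique _ h (hcvg_rip vm)).
Qed.

(** The optimal [t] would be [r / q]; dividing by [q + 1] instead covers [q = 0]. This turns
    minimality or positivity along a line into a bound on the linear coefficient. *)
Lemma linear_le_quadratic (R : realFieldType) (h q r : R) : 0 <= h -> 0 <= q ->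
  (forall t, 2 * t * r <= h ^+ 2 + t ^+ 2 * q) -> `|r| <= h * (q + 1).
Proof.
move=> h0 q0 /(_ (r / (q + 1))) k.
have q1 : 0 < q + 1 by rewrite ltr_wpDl.
have k' : r ^+ 2 <= h ^+ 2 * (q + 1).
  have -> : r ^+ 2 = r ^+ 2 / (q + 1) * (q + 1) by rewrite divfK// gt_eqF.
  rewrite ler_pM2r//.
  have e1 : 2 * (r / (q + 1)) * r = 2 * (r ^+ 2 / (q + 1)) by ring.
  have e2 : (r / (q + 1)) ^+ 2 * q <= r ^+ 2 / (q + 1).
    have -> : (r / (q + 1)) ^+ 2 * q = r ^+ 2 / (q + 1) * (q / (q + 1)).
      by field; rewrite gt_eqF.
    by rewrite ler_piMr ?divr_ge0 ?sqr_ge0 ?(ltW q1)//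
      ler_pdivrMr// mul1r lerDl.
  lra.
rewrite -(ler_pXn2r (ltn0Sn 1)) ?nnegrE ?mulr_ge0 ?addr_ge0//
  exprMn real_normK ?num_real//.
by rewrite (le_trans k')// ler_wpM2l ?sqr_ge0// expr2 ler_peMl// ?lerDr// ltW.
Qed.

(** * Orthogonal projection *)

Section Projection.
Context {R : realType} {H : hilbertType R}.
Implicit Types (M : set H) (x y z : H).

Definition linear_subspace M :=
  M 0 /\ forall (a : R[i]) x y, M x -> M y -> M (a *: x + y).

Definition seq_closed M :=
  forall (u : nat -> H) l, (forall n, M (u n)) -> hcvg u l -> M l.

Lemma linear_subspaceD M x y : linear_subspace M -> M x -> M y -> M (x + y).
Proof. by move=> [_ h] Mx My; rewrite -[x]scale1r; exact: h. Qed.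

Lemma linear_subspaceZ M (a : R[i]) x : linear_subspace M -> M x -> M (a *: x).
Proof. by move=> [M0 h] Mx; rewrite -[_ *: _]addr0; exact: h. Qed.

(** [M] is stable under multiplication by ['i], so real parts control the whole product. *)
Lemma rip_orthocomp M x : linear_subspace M ->
  (forall y, M y -> rip x y = 0) -> orthocomp M x.
Proof.
move=> sM h y My; rewrite inner_rip (h _ My) h//.
exact: linear_subspaceZ.
Qed.

Lemma orthocomp_rip M x y : orthocomp M x -> M y -> rip x y = 0.
Proof. by move=> h My; rewrite /rip h. Qed.

Lemma linear_subspace_orthocomp M : linear_subspace (orthocomp M).
Proof.
split=> [y _|a x x' hx hx' y My]; first by rewrite linear0l.
by rewrite linearPl /= hx// hx'// mulr0 addr0.
Qed.

Lemma orthocomp_self M x : M x -> orthocomp M x -> x = 0.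
Proof. by move=> Mx hx; apply/eqP; rewrite -rip_eq0 (orthocomp_rip hx). Qed.

Lemma parallelogram x y :
  rip (x - y) (x - y) = 2 * rip x x + 2 * rip y y - rip (x + y) (x + y).
Proof. rewrite !(ripBl, ripBr, ripDl, ripDr) (ripC y x); ring. Qed.

(* The points [u n] almost minimize the distance from [x] to [M]: they form a
   Cauchy sequence by the parallelogram law. *)
Lemma projection M x : linear_subspace M -> seq_closed M ->
  exists2 p, M p & orthocomp M (x - p).
Proof.
move=> sM cM.
pose D := [set rip (x - y) (x - y) | y in M].
have D0 : D !=set0 by exists (rip (x - 0) (x - 0)); exists 0 => //; case: sM.
have Dlb : lbound D 0 by move=> _ [y _ <-]; exact: rip_ge0.
have Dinf : has_inf D by split => //; exists 0.
pose d := inf D.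
have dle y : M y -> d <= rip (x - y) (x - y).
  by move=> My; apply: ge_inf; [exists 0|exists y].
have /choice[u uP] n : exists y, M y /\
    rip (x - y) (x - y) < d + (n.+1%:R^-1) ^+ 2.
  have [|_ [y My <-] h] := @inf_adherent _ D (n.+1%:R^-1 ^+ 2) _ Dinf.
    by rewrite exprn_gt0// invr_gt0.
  by exists y.
have hn : (fun n => (2 * n.+1%:R^-1 : R)) @ \oo --> (0 : R).
  rewrite -[X in _ --> X](mulr0 2); apply: cvgMr.
  exact: cvg_harmonic.
have [|p up _] := @hcomplete _ _ u _ hn.
  move=> n k nk; apply: rn_le; first by rewrite mulr_ge0// invr_ge0.
  have [Mn hhn] := uP n; have [Mk hhk] := uP k.
  have e2 : (k.+1%:R^-1 : R) ^+ 2 <= n.+1%:R^-1 ^+ 2.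
    by rewrite lerXn2r ?nnegrE ?invr_ge0// lef_pV2 ?posrE// ler_nat.
  have -> : u k - u n = (x - u n) - (x - u k).
    by rewrite opprB [RHS]addrC addrA subrK.
  rewrite parallelogram.
  (* The midpoint of [u n] and [u k] lies in [M], so its squared distance to [x] is at least [d]. *)
  have hm : 4 * d <= rip ((x - u n) + (x - u k)) ((x - u n) + (x - u k)).
    have -> : (x - u n) + (x - u k) =
        2%:C *: (x - 2^-1%:C *: (u n + u k)).
      rewrite scalerBr scalerA -rmorphM /= divff// scale1r.
      by rewrite rmorph_nat scaler_nat mulr2n opprD addrACA.
    rewrite ripZl ripZr mulrA; have -> : 2 * 2 = 4 :> R by ring.
    by rewrite ler_pM2l// dle//;
      exact: linear_subspaceZ sM (linear_subspaceD sM Mn Mk).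
  rewrite exprMn; move: hhn hhk e2 hm.
  move: (_ ^-1 ^+ 2) (_ ^-1 ^+ 2) (rip _ _) (rip _ _) (rip _ _).
  move=> a b A B C; lra.
have Mp : M p by apply: cM up => n; case: (uP n).
exists p => //; apply: rip_orthocomp => // y My.
suff : rip p y = rip x y by rewrite ripBl => ->; rewrite subrr.
suff h : (fun n => rip (u n) y) @ \oo --> rip x y.
  exact: (cvg_unique _ (hcvg_rip up) h).
(* Almost minimality of [u n] along the line [u n + t y] bounds [rip (x - u n) y] by a multiple of
   [1 / (n + 1)]. *)
apply: (@cvg_dist_le _ _ _ (fun n => n.+1%:R^-1 * (rip y y + 1))); last first.
  by apply: cvg0_mulr; exact: cvg_harmonic.
move=> n; have [Mn hhn] := uP n; rewrite distrC -ripBl.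
apply: linear_le_quadratic (rip_ge0 y) _ => // t.
have := dle _ (linear_subspaceD sM (linear_subspaceZ t%:C sM My) Mn).
have -> : x - (t%:C *: y + u n) = (x - u n) - t%:C *: y.
  by rewrite opprD addrCA [LHS]addrC.
move: (x - u n) hhn => w; rewrite ripBl !ripBr !ripZl !ripZr (ripC y).
move: (_ ^-1 ^+ 2) (rip w w) => a b; nra.
Qed.

End Projection.

(** * Uniform boundedness *)

Section UniformBoundedness.
Context {R : realType} {H : hilbertType R}.
Variable v : nat -> H.
Hypothesis v_gt : forall n, n.*2%:R * 3 ^+ n < rn (v n).

Let v0 n : 0 < rn (v n).
Proof. by rewrite (le_lt_trans _ (v_gt n))// mulr_ge0// exprn_ge0. Qed.

(* The sign is chosen so that the step increases [`|rip x (v n)|]; the later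
   steps, of total length [3 ^- n / 2], cannot undo more than half of it. *)
Let step n (x : H) : R :=
  (if 0 <= rip x (v n) then 1 else -1) * (3^-1 ^+ n / rn (v n)).

Let hump := fix hump n : H :=
  if n is k.+1 then hump k + (step k (hump k))%:C *: v k else 0.

Let hump_norm n : rn (hump n.+1 - hump n) = 3^-1 ^+ n.
Proof.
rewrite /= addrAC subrr add0r rnZ normrM (_ : `|if _ then _ else _| = 1).
  rewrite mul1r ger0_norm ?divfK ?gt_eqF// divr_ge0 ?exprn_ge0 ?ltW//.
by case: ifP; rewrite ?normrN normr1.
Qed.

Let hump_rip n : 3^-1 ^+ n * rn (v n) <= `|rip (hump n.+1) (v n)|.
Proof.
rewrite /= ripDl ripZl -sqr_rn /step -mulrA.
have -> : 3^-1 ^+ n / rn (v n) * rn (v n) ^+ 2 = 3^-1 ^+ n * rn (v n).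
  by rewrite expr2 mulrA divfK// gt_eqF.
have a0 : 0 <= 3^-1 ^+ n * rn (v n) by rewrite mulr_ge0 ?exprn_ge0 ?rn_ge0.
move: (_ * rn _) a0 => a a0.
case: ifPn => [h|]; first by rewrite mul1r ger0_norm ?addr_ge0// lerDr.
rewrite -ltNge => h; rewrite mulN1r ltr0_norm; lra.
Qed.

Let hump_cauchy n k : (n <= k)%N -> rn (hump k - hump n) <= 3 / 2 * 3^-1 ^+ n.
Proof.
move=> nk.
(* This is the exact geometric sum from [n] to [k - 1], a form that the induction on [k]
   preserves. *)
apply: (@le_trans _ _ (3 / 2 * 3^-1 ^+ n - 3 / 2 * 3^-1 ^+ k)); last first.
  by rewrite gerBl mulr_ge0// exprn_ge0.
elim: k nk => [|k ih]; first by rewrite leqn0 => /eqP ->; rewrite !subrr rn0.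
rewrite leq_eqVlt => /orP[/eqP ->|]; first by rewrite !subrr rn0.
rewrite ltnS => /ih {}ih.
have -> : hump k.+1 - hump n = (hump k.+1 - hump k) + (hump k - hump n).
  by rewrite addrA subrK.
rewrite (le_trans (rnD _ _))// hump_norm (exprS _ k).
move: ih; move: (_ ^+ n) (_ ^+ k) => a b; lra.
Qed.

(** After step [n] the product with [v n] has absolute value at least [3^-n rn (v n)]; the later
    steps remove at most half of it, and [v_gt] makes the other half at least [n]. *)
Lemma gliding_hump : exists x, forall n, n%:R <= `|rip x (v n)|.
Proof.
have h0 : (fun n => 3 / 2 * 3^-1 ^+ n : R) @ \oo --> (0 : R).
  rewrite -[X in _ --> X](mulr0 (3 / 2)); apply: cvgMr.
  by apply: cvg_expr; rewrite ger0_norm// invf_lt1// ltr1n.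
have [x _ hx] := hcomplete h0 hump_cauchy.
exists x => n; have e0 : 0 <= 3^-1 ^+ n * rn (v n).
  by rewrite mulr_ge0 ?exprn_ge0 ?rn_ge0.
have h1 : `|rip (x - hump n.+1) (v n)| <= 2^-1 * (3^-1 ^+ n * rn (v n)).
  rewrite (le_trans (abs_rip_le _ _))// mulrA ler_wpM2r ?rn_ge0//.
  rewrite (le_trans (hx _))// exprS mulrA ler_wpM2r ?exprn_ge0//.
  by rewrite -mulrA mulrCA divff// mulr1.
have h2 := hump_rip n.
have h3 : `|rip (hump n.+1) (v n)| <=
    `|rip x (v n)| + `|rip (x - hump n.+1) (v n)|.
  have -> : rip (hump n.+1) (v n) = rip x (v n) - rip (x - hump n.+1) (v n).
    by rewrite ripBl opprB addrC subrK.
  exact: ler_normB.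
have h4 : n.*2%:R <= 3^-1 ^+ n * rn (v n).
  by rewrite exprVn mulrC ler_pdivlMr ?exprn_gt0// ltW.
rewrite -muln2 natrM in h4.
move: h1 h2 h3 h4; move: (`|_|) (`|_|) (`|_|) (_ * rn _) => a b c d; lra.
Qed.

End UniformBoundedness.

(** An unbounded [V] would contain a sequence growing as [v_gt] asks, and the gliding hump would be
    a point where [V] is not pointwise bounded. *)
Lemma uniform_boundedness (R : realType) (H : hilbertType R) (V : set H) :
  (forall x, exists M, forall v, V v -> `|rip x v| <= M) ->
  exists2 c, 0 < c & forall v, V v -> rn v <= c.
Proof.
move=> hV; apply: contrapT => h.
have /choice[v hv] n : exists v, V v /\ n.*2%:R * 3 ^+ n < rn v.
  apply: contrapT => k; apply: h; exists (n.*2%:R * 3 ^+ n + 1).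
    by rewrite ltr_wpDl// mulr_ge0// exprn_ge0.
  move=> v Vv; rewrite ler_wpDr// leNgt; apply/negP => l.
  by apply: k; exists v.
have [x hx] := gliding_hump (fun n => (hv n).2).
have [M hM] := hV x.
have := le_trans (hx (Num.truncn M).+1) (hM _ (hv _).1).
by rewrite leNgt truncnS_gt.
Qed.

(** * Graphs of operators in the Hilbert sum *)

Section HilbertSum.
Context {R : realType} {H K : hilbertType R}.
Implicit Types (u v : hsum H K).

Lemma rip_hsum u v : rip u v = rip u.1 v.1 + rip u.2 v.2.
Proof. by rewrite /rip -raddfD. Qed.

Lemma rn_fst u : rn u.1 <= rn u.
Proof. by apply: rn_le; rewrite ?rn_ge0// sqr_rn rip_hsum lerDl rip_ge0. Qed.

Lemma rn_snd u : rn u.2 <= rn u.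
Proof. by apply: rn_le; rewrite ?rn_ge0// sqr_rn rip_hsum lerDr rip_ge0. Qed.

(** The set [graph T] placed inside [hsum H K], where orthogonal projection applies; [graph] itself
    lives in the product with the sup norm. *)
Definition hgraph (T : operator H K) : set (hsum H K) :=
  [set u | dom T u.1 /\ u.2 = T u.1].

Lemma seq_closed_hgraph (T : operator H K) : closed_op T ->
  seq_closed (hgraph T).
Proof.
move=> [_ cT] u l uT ul.
have u1 : hcvg (fun n => (u n).1) l.1.
  by apply: (hcvg_le _ ul) => n; exact: (@rn_fst (u n - l)).
have u2 : hcvg (fun n => (u n).2) l.2.
  by apply: (hcvg_le _ ul) => n; exact: (@rn_snd (u n - l)).
move/hcvgE : u1; move/hcvgE : u2 => u2 u1.
apply: (closed_cvg (graph T) cT _ _ (cvg_pair u1 u2)).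
exact: nearW.
Qed.

Lemma linear_subspace_hgraph (T : operator H K) :
  linear_op T -> linear_subspace (hgraph T).
Proof.
move=> [d0 dl Tl]; split=> [|a x y [dx ex] [dy ey]].
  split => //; have := Tl (-1) 0 0 d0 d0.
  by rewrite scaler0 addr0 scaleN1r addNr.
by split; [exact: dl|rewrite /= ex ey Tl].
Qed.

End HilbertSum.

(** * Adjoints of everywhere defined operators *)

Section EverywhereDefinedAdjoint.
Context {R : realType} {H K : hilbertType R}.
Variable f : {linear K -> H}.

(** Since [f] commutes with ['i], the real identity at ['i *: y] supplies the imaginary part. *)
Lemma rip_adjoint z w :
  (forall y, rip (f y) z = rip y w) -> forall y, '[f y, z] = '[y, w].
Proof.
move=> h y; rewrite innerC [RHS]innerC; congr (_ ^*).
by apply: eq_inner_rip; rewrite -?linearZ ripC h ripC.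
Qed.

Definition adjoint_dom : set H :=
  [set z | exists w, forall y, '[f y, z] = '[y, w]].

Lemma linear_subspace_adjoint_dom : linear_subspace adjoint_dom.
Proof.
split=> [|a z z' [w hw] [w' hw']].
  by exists 0 => y; rewrite !linear0r.
by exists (a *: w + w') => y; rewrite !linearPr /= hw hw'.
Qed.

(** For [z] in the unit ball, [|rip y w| = |rip (f y) z| <= rn (f y)], so the vectors [w] are
    pointwise bounded and uniform boundedness applies; scaling gives the general case. *)
Lemma adjoint_bounded : exists2 c, 0 < c &
  forall z w, (forall y, '[f y, z] = '[y, w]) -> rn w <= c * rn z.
Proof.
pose V := [set w | exists2 z, rn z <= 1 & forall y, '[f y, z] = '[y, w]].
have [|c c0 hc] := @uniform_boundedness _ _ V.
  move=> y; exists (rn (f y)) => w [z z1 hz].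
  rewrite /rip -hz (le_trans (abs_rip_le _ _))//.
  by rewrite ler_piMr ?rn_ge0.
exists c => // z w hz.
have [z0|z0] := eqVneq z 0.
  suff -> : w = 0 by rewrite rn0 mulr_ge0 ?rn_ge0// ltW.
  by apply/eqP; rewrite -rip_eq0 {1}/rip -hz z0 linear0r.
have zp : 0 < rn z by rewrite lt_def rn_eq0 z0 rn_ge0.
rewrite -ler_pdivrMr// mulrC.
have -> : (rn z)^-1 * rn w = rn ((rn z)^-1%:C *: w).
  by rewrite rnZ ger0_norm// invr_ge0 rn_ge0.
apply: hc; exists ((rn z)^-1%:C *: z) => [|y].
  by rewrite rnZ ger0_norm ?invr_ge0 ?rn_ge0// mulVf// gt_eqF.
by rewrite !linearZr_LR /= hz.
Qed.

(** By [adjoint_bounded] the adjoint vectors along a convergent sequence are Cauchy, and their limit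
    is an adjoint vector of the limit. *)
Lemma seq_closed_adjoint_dom : seq_closed adjoint_dom.
Proof.
have [c c0 hc] := adjoint_bounded.
move=> u l uD ul; have /choice[w hw] := uD.
have [d d0|m wm] := @hcvg_cauchy _ _ w.
  have d1 : 0 < d / c / 2 by rewrite !divr_gt0.
  move/cvgr0Pnorm_lt : ul => /(_ _ d1)[N _ hN]; exists N => n Nn.
  have h y : '[f y, u n - u N] = '[y, w n - w N] by rewrite !linearBr /= !hw.
  apply: le_lt_trans (hc _ _ h) _; rewrite mulrC -ltr_pdivlMr//.
  have -> : u n - u N = (u n - l) - (u N - l) by rewrite opprB addrA subrK.
  rewrite (le_lt_trans (rnD _ _))// rnN (splitr (d / c)).
  by apply: ltrD; apply: le_lt_trans (ler_norm _) (hN _ _); rewrite /=.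
exists m; apply: rip_adjoint => y; rewrite ripC [RHS]ripC.
by apply: (hcvg_rip_eq ul wm) => n; rewrite ripC [RHS]ripC /rip hw.
Qed.

(** By projection, a closed subspace with trivial orthogonal complement is the whole space. *)
Lemma everywhere_adjoint : (forall v, orthocomp adjoint_dom v -> v = 0) ->
  exists2 g : H -> K, forall y z, '[f y, z] = '[y, g z] &
  exists2 c, 0 < c & forall z, rn (g z) <= c * rn z.
Proof.
move=> D0; have DT z : adjoint_dom z.
  have [p Dp] :=
    projection z linear_subspace_adjoint_dom seq_closed_adjoint_dom.
  by move=> /D0/eqP; rewrite subr_eq0 => /eqP ->.
have /choice[g hg] := DT; exists g => [y z|]; first exact: hg.
have [c c0 hc] := adjoint_bounded; exists c => // z; apply: hc => y; exact: hg.
Qed.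

End EverywhereDefinedAdjoint.

(** * The Moore-Penrose inverse *)

Section MoorePenrose.
Context {R : realType} {H K : hilbertType R}.
Variable T : operator H K.
Hypothesis lT : linear_op T.

Let T0 : T 0 = 0.
Proof. by have [_ <-] := (linear_subspace_hgraph lT).1. Qed.

Let TB x x' : dom T x -> dom T x' -> dom T (x - x') /\ T (x - x') = T x - T x'.
Proof.
case: lT => _ dl Tl dx dx'.
have := dl (-1) x' x dx' dx; have := Tl (-1) x' x dx' dx.
by rewrite !scaleN1r addrC [in X in _ = X]addrC => -> ?.
Qed.

Lemma linear_subspace_ran : linear_subspace (ran T).
Proof.
case: lT => d0 dl Tl; split; first by exists 0.
move=> a _ _ [x dx <-] [x' dx' <-]; exists (a *: x + x'); first exact: dl.
exact: Tl.
Qed.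

Lemma linear_subspace_nullspace : linear_subspace (nullspace T).
Proof.
case: lT => d0 dl Tl; split=> [//|a x x' [dx ex] [dx' ex']].
by split; [exact: dl|rewrite Tl// ex ex' scaler0 addr0].
Qed.

(** The difference lies both in the null space and in its orthogonal complement. *)
Lemma carrier_inj x x' : carrier T x -> carrier T x' -> T x = T x' -> x = x'.
Proof.
move=> [dx ox] [dx' ox'] e; apply/eqP; rewrite -subr_eq0; apply/eqP.
have [d eq] := TB dx dx'.
apply: (@orthocomp_self _ _ (nullspace T)).
  by split; rewrite // eq e subrr.
rewrite addrC -scaleN1r.
by have [_] := linear_subspace_orthocomp (nullspace T); exact.
Qed.

(* The least-squares characterization of the Moore-Penrose inverse. *)
Definition mp_rel y x := carrier T x /\ orthocomp (ran T) (y - T x).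

Lemma mp_rel_ran y x y1 y2 : mp_rel y x -> ran T y1 -> orthocomp (ran T) y2 ->
  y = y1 + y2 -> y1 = T x.
Proof.
move=> [[dx _] oy] r1 o2 e; apply/eqP; rewrite -subr_eq0; apply/eqP.
apply: (@orthocomp_self _ _ (ran T)).
  case: r1 => x1 dx1 <-; have [d eq] := TB dx1 dx.
  by exists (x1 - x).
have -> : y1 - T x = (-1) *: y2 + (y - T x).
  by rewrite e scaleN1r addrA [_ + y2]addrC addKr.
by have [_] := linear_subspace_orthocomp (ran T); exact.
Qed.

(** Both choices made by [xget] are forced: [mp_rel_ran] fixes the component in the range,
    [carrier_inj] its preimage. *)
Lemma moore_penroseP y x : mp_rel y x ->
  dom (moore_penrose T) y /\ moore_penrose T y = x.
Proof.
move=> yx; have [[dx ox] oy] := yx.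
have rx : ran T (T x) by exists x.
have inv : op_inv (op_restrict T (carrier T)) (T x) = x.
  apply: xget_unique => [|x' [[_ cx'] ex']]; first by [].
  exact: carrier_inj ex'.
split; first by exists (T x), (y - T x); rewrite subrKC.
apply: xget_unique; first by exists (T x), (y - T x); rewrite subrKC.
by move=> x' [y1 [y2 [r1 o2 e ->]]]; rewrite (mp_rel_ran yx r1 o2 e).
Qed.

Lemma mp_rel_fun y x x' : mp_rel y x -> mp_rel y x' -> x = x'.
Proof. by move=> /moore_penroseP[_ <-] /moore_penroseP[_ ->]. Qed.

Lemma mp_rel_linear (a : R[i]) y x y' x' : mp_rel y x -> mp_rel y' x' ->
  mp_rel (a *: y + y') (a *: x + x').
Proof.
case: (lT) => d0 dl Tl [[dx ox] oy] [[dx' ox'] oy']; split.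
  split; first exact: dl.
  by have [_] := linear_subspace_orthocomp (nullspace T); exact.
rewrite Tl// opprD addrACA -scalerBr.
by have [_] := linear_subspace_orthocomp (ran T); exact.
Qed.

End MoorePenrose.

Section MoorePenroseClosed.
Context {R : realType} {H K : hilbertType R}.
Variable T : operator H K.
Hypothesis cT : closed_op T.
Hypothesis rT : closed (ran T).

Let lT : linear_op T. Proof. by case: cT. Qed.

(** The pairs [(u n, 0)] converge inside the closed graph. *)
Lemma seq_closed_nullspace : seq_closed (nullspace T).
Proof.
move=> u l uN ul.
have [||dl Tl] := seq_closed_hgraph cT (u := fun n => (u n, 0)) (l := (l, 0)).
- by move=> n; have [d e] := uN n; split.
- apply: (hcvg_le _ ul) => n; apply: rn_le; first exact: rn_ge0.
  by rewrite sqr_rn rip_hsum /= subrr rip0l addr0.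
by split => //; rewrite -Tl.
Qed.

(** Two projections are used: [y] onto the closed range, then a preimage onto the null space.
    Subtracting the null component puts the preimage in the carrier and keeps its image. *)
Lemma mp_rel_total y : exists x, mp_rel T y x.
Proof.
have [||p [x0 d0 <-] oy] := @projection _ _ (ran T) y.
- exact: linear_subspace_ran.
- by move=> u l; exact: hcvg_closed.
have [q [dq Tq] ox] :=
  projection x0 (linear_subspace_nullspace lT) seq_closed_nullspace.
have [_ dl Tl] := lT.
have dx : dom T (x0 - q) by rewrite addrC -scaleN1r; exact: dl.
have Tx : T (x0 - q) = T x0.
  by rewrite addrC -scaleN1r Tl// Tq scaler0 add0r.
by exists (x0 - q); split; [split|rewrite Tx].
Qed.

Lemma mp_relP y : mp_rel T y (moore_penrose T y).
Proof.
by have [x h] := mp_rel_total y; have [_ ->] := moore_penroseP lT h.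
Qed.

Lemma dom_moore_penrose : dom (moore_penrose T) = setT.
Proof.
apply/seteqP; split=> // y _.
by have [] := moore_penroseP lT (mp_relP y).
Qed.

Lemma moore_penrose_linear : linear (moore_penrose T).
Proof.
move=> a y y'; apply: (mp_rel_fun lT (mp_relP _)).
by apply: mp_rel_linear => //; exact: mp_relP.
Qed.

(** [T] composed with [f] is the orthogonal projection onto the range, hence symmetric. *)
Lemma mp_rel_inner y y' : let f := moore_penrose T in
  '[T (f y), y'] = '[y, T (f y')].
Proof.
have [[dx _] ox] := mp_relP y; have [[dx' _] ox'] := mp_relP y'.
rewrite /=; transitivity '[T (moore_penrose T y), T (moore_penrose T y')].
  apply/eqP; rewrite -subr_eq0 -linearBr /= herm_eq0C; apply/eqP/ox'.
  by exists (moore_penrose T y).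
apply/esym/eqP; rewrite -subr_eq0 -linearBl /=; apply/eqP/ox.
by exists (moore_penrose T y').
Qed.

Definition mp_linear : {linear K -> H} :=
  HB.pack (moore_penrose T : K -> H)
    (GRing.isLinear.Build _ _ _ _ (moore_penrose T : K -> H)
      moore_penrose_linear).

(* The domain of the adjoint of the Moore-Penrose inverse contains the null
   space of T and the range of the adjoint of T; a vector orthogonal to
   both is seen to vanish by projecting (v, 0) on the graph of T. *)
Lemma orthocomp_adjoint_dom_mp v : orthocomp (adjoint_dom mp_linear) v -> v = 0.
Proof.
move=> hv.
have [[a Ta] /= [da eTa] og] :=
  projection ((v, 0) : hsum H K) (linear_subspace_hgraph lT)
    (seq_closed_hgraph cT).
have {}eTa : Ta = T a := eTa; subst Ta.
(* Orthogonality of [(v - a, - T a)] to the graph says that [v - a] is the adjoint of [T] applied to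
   [T a]. *)
have hg x : dom T x -> '[x, v - a] = '[T x, T a].
  move=> dx; rewrite innerC [RHS]innerC; congr (_ ^*).
  have : '[v - a, x] + '[0 - T a, T x] = 0 by apply: (og (x, T x)); split.
  by rewrite sub0r linearNl /= => /eqP; rewrite subr_eq0 => /eqP.
have D1 : adjoint_dom mp_linear (v - a).
  exists (T (moore_penrose T (T a))) => y.
  by have [[d _] _] := mp_relP y; rewrite hg// mp_rel_inner.
have h1 : rip v (v - a) = 0 := orthocomp_rip hv D1.
have h2 : rip a (v - a) = rip (T a) (T a) by rewrite /rip hg.
(* One squared norm is the opposite of another, so both vanish. *)
have h3 : rip (v - a) (v - a) = - rip (T a) (T a) by rewrite ripBl h1 h2 sub0r.
have := rip_ge0 (v - a); have := rip_ge0 (T a) => p1 p2.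
have /eqP : rip (v - a) (v - a) = 0 by lra.
rewrite rip_eq0 subr_eq0 => /eqP va.
have /eqP : rip (T a) (T a) = 0 by lra.
rewrite rip_eq0 => /eqP Ta0.
(* Now [v = a] is in the null space, to which all values of the Moore-Penrose inverse are
   orthogonal. So [v] lies in the adjoint domain, with adjoint vector 0, and is orthogonal to
   itself. *)
apply: (orthocomp_self _ hv); exists 0 => y; rewrite linear0r.
by have [[_ o] _] := mp_relP y; apply: o; rewrite va.
Qed.

End MoorePenroseClosed.

(** * Positive square roots *)

Section PositiveSquareRoot.
Context {R : realType} {H : hilbertType R}.
Implicit Types (x y : H).

Definition symmetric_fun (S : H -> H) := forall x y, '[S x, y] = '[x, S y].

(** The counterpart of [is_sqrt] for everywhere defined maps, see [is_sqrtP]; the real part suffices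
    for positivity because symmetry makes ['[S x, x]] real. *)
Definition sqrt_fun (A S : H -> H) := [/\ linear S, symmetric_fun S,
  forall x, 0 <= rip (S x) x & forall x, S (S x) = A x].

Lemma linear_funB (S : H -> H) (lS : linear S) x y : S (x - y) = S x - S y.
Proof.
by have := lS (-1) y x; rewrite !scaleN1r => e; rewrite addrC e addrC.
Qed.

Lemma linear_funD (S : H -> H) (lS : linear S) x y : S (x + y) = S x + S y.
Proof. by have := lS 1 x y; rewrite !scale1r. Qed.

Lemma linear_fun0 (S : H -> H) (lS : linear S) : S 0 = 0.
Proof. by have := linear_funB lS 0 0; rewrite !subrr. Qed.

Lemma linear_funZ (S : H -> H) (lS : linear S) (a : R[i]) x :
  S (a *: x) = a *: S x.
Proof. by have := lS a x 0; rewrite (linear_fun0 lS) !addr0. Qed.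

Lemma symmetric_rip (S : H -> H) x y :
  symmetric_fun S -> rip (S x) y = rip x (S y).
Proof. by move=> h; rewrite /rip h. Qed.

Lemma rip_symmetric (S : H -> H) : linear S ->
  (forall x y, rip (S x) y = rip x (S y)) -> symmetric_fun S.
Proof. by move=> lS h x y; apply: eq_inner_rip; rewrite -?(linear_funZ lS). Qed.

(** Positivity at [x - t y] reads [2 t rip (S x) y <= t^2 rip (S y) y], the case [h = 0] of
    [linear_le_quadratic]. *)
Lemma positive_ker (S : H -> H) x : linear S -> symmetric_fun S ->
  (forall x, 0 <= rip (S x) x) -> rip (S x) x = 0 -> S x = 0.
Proof.
move=> lS sS pS Sx0; apply: rip_nondeg => y; apply/eqP; rewrite -normr_le0.
rewrite -[leRHS](mul0r (rip (S y) y + 1)).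
apply: linear_le_quadratic => // t.
have := pS (x - t%:C *: y).
rewrite (linear_funB lS) (linear_funZ lS) ripBl !ripBr !ripZl !ripZr Sx0.
rewrite (symmetric_rip y x sS) (ripC y); nra.
Qed.

Section Construction.
Variables (A : H -> H) (c : R).
Hypotheses (lA : linear A) (sA : symmetric_fun A) (c0 : 0 < c).
(** For symmetric [A] this amounts to [0 <= A <= c^2]. *)
Hypothesis bA : forall x, rip (A x) (A x) <= c ^+ 2 * rip (A x) x.

Let C x := x - (c ^- 2)%:C *: A x.

(** These are polynomials in [C] with nonnegative coefficients, converging to 1 minus the square
    root of [1 - C]. *)
Fixpoint sqrt_iter n x : H :=
  if n is k.+1 then 2^-1%:C *: (C x + sqrt_iter k (sqrt_iter k x)) else 0.

(* Majorizes the norms of [sqrt_iter n] and of the increments. *)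
Fixpoint sqrt_bound n : R :=
  if n is k.+1 then 2^-1 * (1 + sqrt_bound k ^+ 2) else 0.

Local Notation Y := sqrt_iter.
Local Notation t := sqrt_bound.

Let C_lin : linear C.
Proof.
move=> a x y; rewrite /C lA scalerDr scalerBr opprD addrACA !scalerA.
by rewrite (mulrC a).
Qed.

Let C_sym x y : rip (C x) y = rip x (C y).
Proof. by rewrite ripBl ripBr ripZl ripZr (symmetric_rip _ _ sA). Qed.

Let C_le x : rn (C x) <= rn x.
Proof.
apply: rn_le (rn_ge0 x) _; rewrite sqr_rn ripBl !ripBr !ripZl !ripZr.
rewrite (ripC x) -subr_ge0; set a := rip (A x) x; set b := rip (A x) (A x).
have bc : c ^- 2 * b <= a.
  by rewrite mulrC ler_pdivrMr ?exprn_gt0// mulrC bA.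
have b0 : 0 <= c ^- 2 * b.
  by rewrite mulr_ge0 ?rip_ge0// invr_ge0 exprn_ge0// ltW.
have -> : rip x x -
    (rip x x - c ^- 2 * a - (c ^- 2 * a - c ^- 2 * (c ^- 2 * b)))
  = c ^- 2 * (2 * a - c ^- 2 * b) by ring.
by apply: mulr_ge0; [rewrite invr_ge0 exprn_ge0// ltW|lra].
Qed.

Let Y_lin n : linear (Y n).
Proof.
elim: n => [|n ih] a x y /=; first by rewrite scaler0 addr0.
by rewrite C_lin !ih addrACA -(scalerDr a) [LHS]scalerDr !scalerA
  [_%:C * a]mulrC.
Qed.

Let Y_sym n x y : rip (Y n x) y = rip x (Y n y).
Proof.
elim: n x y => [|n ih] x y /=; first by rewrite rip0l rip0r.
by rewrite ripZl ripZr ripDl ripDr C_sym !ih.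
Qed.

Let Y_comm n (F : H -> H) : linear F -> (forall x, F (A x) = A (F x)) ->
  forall x, F (Y n x) = Y n (F x).
Proof.
move=> lF FA; elim: n => [|n ih] x /=; first by rewrite (linear_fun0 lF).
by rewrite (linear_funZ lF) (linear_funD lF) !ih /C (linear_funB lF)
  (linear_funZ lF) FA.
Qed.

Let t01 n : 0 <= t n <= 1.
Proof. elim: n => [|n] /=; [by rewrite lexx ler01|nra]. Qed.

Let tS n : t n <= t n.+1.
Proof. have := t01 n; rewrite /=; nra. Qed.

Let Y_le n x : rn (Y n x) <= t n * rn x.
Proof.
elim: n x => [|n ih] x /=; first by rewrite rn0 mul0r.
rewrite rnZ ger0_norm// -mulrA ler_pM2l// mulrDl mul1r.
rewrite (le_trans (rnD _ _))// lerD// (le_trans (ih _))// expr2 -mulrA.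
by rewrite ler_wpM2l//; case/andP: (t01 n).
Qed.

Let Y_step n x : rn (Y n.+1 x - Y n x) <= (t n.+1 - t n) * rn x.
Proof.
elim: n x => [|n ih] x.
  rewrite /= subr0 addr0 rnZ ger0_norm// subr0 expr0n addr0 mulr1.
  by rewrite ler_pM2l.
(* The difference of squares is split as [Y' (Y' - Y) + (Y' - Y) Y]; [t] obeys the same identity, so
   the bounds match term by term. *)
have -> : Y n.+2 x - Y n.+1 x = 2^-1%:C *:
    (Y n.+1 (Y n.+1 x - Y n x) + (Y n.+1 (Y n x) - Y n (Y n x))).
  rewrite (linear_funB (Y_lin _)) addrA subrK.
  by rewrite [Y n.+2 x]/= [in LHS]/= -scalerBr opprD addrACA subrr add0r.
have -> : t n.+2 - t n.+1 =
    2^-1 * (t n.+1 * (t n.+1 - t n) + (t n.+1 - t n) * t n).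
  by rewrite [t n.+2]/=; have -> : t n.+1 = 2^-1 * (1 + t n ^+ 2) by []; ring.
rewrite rnZ ger0_norm// -mulrA ler_pM2l// mulrDl (le_trans (rnD _ _))// lerD//.
  rewrite (le_trans (Y_le _ _))// -mulrA ler_wpM2l ?ih//.
  by case/andP: (t01 n.+1).
by rewrite (le_trans (ih _))// -mulrA ler_wpM2l ?Y_le// subr_ge0.
Qed.

Let Y_dist n k x : (n <= k)%N -> rn (Y k x - Y n x) <= (t k - t n) * rn x.
Proof.
elim: k => [|k ih]; first by rewrite leqn0 => /eqP ->; rewrite !subrr rn0 mul0r.
rewrite leq_eqVlt => /orP[/eqP ->|]; first by rewrite !subrr rn0 mul0r.
rewrite ltnS => /ih {}ih.
have -> : Y k.+1 x - Y n x = (Y k.+1 x - Y k x) + (Y k x - Y n x).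
  by rewrite addrA subrK.
have -> : t k.+1 - t n = (t k.+1 - t k) + (t k - t n) by rewrite addrA subrK.
by rewrite (le_trans (rnD _ _))// mulrDl lerD.
Qed.

(** The increments are dominated by those of [t], which is nondecreasing and bounded by 1, so
    [s - t n] times [rn x] is a rate of convergence. *)
Let Y_cvg x : exists l, hcvg (fun n => Y n x) l.
Proof.
have nd : {homo t : n k / (n <= k)%N >-> n <= k} by apply/nondecreasing_seqP.
have ub : has_ubound (range t) by exists 1 => _ [n _ <-]; case/andP: (t01 n).
have tl := nondecreasing_cvgn nd ub.
set s := sup _ in tl.
have e0 : (fun n => (s - t n) * rn x) @ \oo --> (0 : R).
  apply: cvg0_mulr; rewrite -(subrr s); apply: cvgB => //; exact: cvg_cst.
have [n k nk|l ul _] := @hcomplete _ _ (fun n => Y n x) _ e0; last by exists l.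
rewrite (le_trans (Y_dist _ nk))// ler_wpM2r ?rn_ge0// lerD2r.
by apply: ub_le_sup => //; exists k.
Qed.

(* The limit [L] of [Y] satisfies [L = (C + L^2) / 2], that is
   [(1 - L)^2 = 1 - C = A / c^2], so that [c (1 - L)] is the root. *)
Lemma sqrt_fun_exists : exists2 S, sqrt_fun A S &
  forall F : H -> H, linear F -> symmetric_fun F ->
    (forall x, F (A x) = A (F x)) -> forall x, F (S x) = S (F x).
Proof.
have /choice[L YL] := Y_cvg.
have L_lin : linear L.
  move=> a x y; apply: hcvg_unique (YL _) _.
  by apply: (hcvg_ext _ (hcvg_lin a (YL x) (YL y))) => n; rewrite Y_lin.
have L_sym x y : rip (L x) y = rip x (L y).
  by rewrite (ripC x); apply: (hcvg_rip_eq (YL x) (YL y)) => n;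
    rewrite Y_sym ripC.
have L_le x : rn (L x) <= rn x.
  apply: (hcvg_rn_le (YL x)) => n; rewrite (le_trans (Y_le _ _))//.
  by rewrite ler_piMl ?rn_ge0//; case/andP: (t01 n).
have L_fix x : L x = 2^-1%:C *: (C x + L (L x)).
  apply: hcvg_unique (hcvg_shift (YL x)) _; rewrite /=.
  apply/hcvgZ/hcvgD; first exact: hcvg_cst.
  apply: (@hcvg_le _ _ _ _
    (fun n => rn (Y n x - L x) + rn (Y n (L x) - L (L x)))).
    (* [Y n] is a contraction, so comparison through [Y n (L x)] leaves only limits already
       known. *)
    move=> n; have -> : Y n (Y n x) - L (L x) =
        Y n (Y n x - L x) + (Y n (L x) - L (L x)).
      by rewrite (linear_funB (Y_lin _)) addrA subrK.
    rewrite (le_trans (rnD _ _))// lerD2r (le_trans (Y_le _ _))//.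
    by rewrite ler_piMl ?rn_ge0//; case/andP: (t01 n).
  by rewrite -[X in _ --> X]addr0; apply: cvgD; exact: YL.
pose S x := c%:C *: (x - L x).
have S_lin : linear S.
  move=> a x y; rewrite /S L_lin opprD addrACA -scalerBr scalerDr !scalerA.
  by rewrite mulrC.
exists S; first split => //.
- apply: rip_symmetric => // x y.
  by rewrite ripZl ripZr ripBl ripBr L_sym.
- move=> x; rewrite ripZl ripBl mulr_ge0 ?(ltW c0)// subr_ge0 -sqr_rn.
  by rewrite (le_trans (rip_le _ _))// expr2 ler_wpM2r ?rn_ge0.
- move=> x; rewrite {1}/S.
  have -> : S x - L (S x) = c%:C *: (x - L x - (L x - L (L x))).
    by rewrite /S (linear_funZ L_lin) (linear_funB L_lin) -scalerBr.
  have -> : x - L x - (L x - L (L x)) = (c ^- 2)%:C *: A x.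
    have : (2%:C : R[i]) *: L x = C x + L (L x).
      by rewrite {1}L_fix scalerA -rmorphM /= divff// scale1r.
    rewrite (_ : 2%:C = 2) ?rmorph_nat// scaler_nat mulr2n => e.
    rewrite opprB addrACA -opprD e opprD addrACA subrr addr0.
    by rewrite /C opprB addrCA subrr addr0.
  by rewrite !scalerA -!rmorphM -expr2 divff ?scale1r// expf_neq0// gt_eqF.
(* [F] is not assumed continuous: symmetry moves it to the test vector, and the limit is taken
   weakly. *)
- move=> F lF sF FA x; rewrite /S (linear_funZ lF) (linear_funB lF).
  congr (_ *: (_ - _)); apply: rip_ext => z.
  rewrite (symmetric_rip _ _ sF); apply: (hcvg_rip_eq (YL x) (YL (F x))) => n.
  by rewrite -(symmetric_rip _ _ sF) (Y_comm _ lF FA).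
Qed.

(* Any root Q commutes with A, hence with the constructed root P, so that
   (Q + P)(Q - P) = 0. *)
Lemma sqrt_fun_unique (S S' : H -> H) :
  sqrt_fun A S -> sqrt_fun A S' -> S =1 S'.
Proof.
have [P [lP sP pP PP] Pc] := sqrt_fun_exists.
suff key Q : sqrt_fun A Q -> Q =1 P by move=> /key e /key e' x; rewrite e e'.
move=> [lQ sQ pQ QQ] x.
have {}Pc y : Q (P y) = P (Q y) by apply: Pc => // z; rewrite -!QQ.
pose y := Q x - P x.
have e : Q y + P y = 0.
  rewrite /y (linear_funB lQ) (linear_funB lP) QQ PP Pc addrA subrK subrr //.
have re : rip (Q y) y + rip (P y) y = 0 by rewrite -ripDl e rip0l.
have qy := pQ y; have py := pP y.
have Q0 : Q y = 0 by apply: positive_ker => //; lra.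
have P0 : P y = 0 by apply: positive_ker => //; lra.
(* Symmetry turns the squared norm of [y] into [rip x (Q y) - rip x (P y)]. *)
apply/eqP; rewrite -subr_eq0 -rip_eq0 -/y {1}/y ripBl.
by rewrite (symmetric_rip _ _ sQ) (symmetric_rip _ _ sP) Q0 P0 rip0r subrr.
Qed.

End Construction.
End PositiveSquareRoot.

(** * Absolute values of everywhere defined operators *)

Section AbsoluteValue.
Context {R : realType}.

Lemma adjoint_everywhere (H K : hilbertType R) (T : operator H K) (g : K -> H) :
  dom T = setT -> (forall x y, '[T x, y] = '[x, g y]) ->
  dom (adjoint T) = setT /\ forall y, adjoint T y = g y.
Proof.
move=> dT Tg; split.
  by apply/seteqP; split=> // y _; exists (g y) => x _.
move=> y; apply: xget_unique => [x _|z hz]; first exact: Tg.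
apply: rip_ext => x; rewrite ripC [RHS]ripC.
by rewrite /rip -Tg hz// dT.
Qed.

(** The domain of [S] contains that of its square, so a root of an everywhere defined operator is
    everywhere defined. *)
Lemma is_sqrtP (H : hilbertType R) (A S : operator H H) : dom A = setT ->
  is_sqrt A S <-> dom S = setT /\ sqrt_fun A S.
Proof.
move=> dA; split.
  move=> [[_ _ lS] [_ [dS' eS]] pS [dSS eSS]].
  have dS : dom S = setT.
    apply/seteqP; split=> // x _.
    have : dom (op_comp S S) x by rewrite dSS dA.
    by case.
  have sS : symmetric_fun S.
    move=> x y; rewrite -(eS y) ?dS' ?dS//.
    have [z hz] : dom (adjoint S) y by rewrite dS' dS.
    apply: (@xgetPex _ 0 [set z | forall x, dom S x -> '[S x, y] = '[x, z]]).
      by exists z.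
    by rewrite dS.
  split=> //; split=> //.
  - by move=> a x y; apply: lS; rewrite dS.
  - move=> x; have := pS x; rewrite dS => /(_ Logic.I).
    by rewrite lecE => /andP[].
  - by move=> x; have := eSS x; rewrite dSS dA; apply.
move=> [dS [lS sS pS SS]].
have [dS' eS] := adjoint_everywhere dS sS.
split.
- by split; rewrite dS// => a x y _ _; exact: lS.
- split; last by split; [rewrite dS' dS|move=> x _; exact: eS].
  by rewrite /densely_defined dS => O [x Ox] _; exists x.
(* The order of [R[i]] also asks that ['[S x, x]] be real, which symmetry gives. *)
- move=> x _; rewrite lecE /= pS andbT.
  have : '[S x, x] = '[S x, x]^* by rewrite -innerC sS.
  by case: '[S x, x] => u v [] /= ?; apply/eqP; lra.
- by split=> [|x _]; [apply/seteqP; split=> x; rewrite dA //= dS|exact: SS].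
Qed.

(** Here [g] is the adjoint of [T]; the bound [rn (g (T x)) <= c * rn (T x)] and the identity
    [rip (g (T x)) x = rn (T x) ^+ 2] give the estimate [bA]. *)
Lemma op_absP (H K : hilbertType R) (T : operator H K) (g : K -> H) (c : R) :
  dom T = setT -> linear T -> (forall x y, '[T x, y] = '[x, g y]) ->
  0 < c -> (forall y, rn (g y) <= c * rn y) ->
  [/\ dom (op_abs T) = setT, sqrt_fun (g \o T) (op_abs T) &
      forall S, sqrt_fun (g \o T) S -> S =1 op_abs T].
Proof.
move=> dT lT Tg c0 gc.
have [dTa eTa] := adjoint_everywhere dT Tg.
have dA : dom (op_comp (adjoint T) T) = setT.
  by apply/seteqP; split=> // x _; split; rewrite ?dT ?dTa.
have lg : linear g.
  move=> a x y; apply: rip_ext => z; rewrite ripC [RHS]ripC.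
  by rewrite /rip linearPr /= -!Tg linearPr.
have lA : linear (g \o T) by move=> a x y /=; rewrite lT lg.
have sA : symmetric_fun (g \o T).
  by move=> x y /=; rewrite -Tg innerC -Tg -innerC.
have bA x : rip ((g \o T) x) ((g \o T) x) <= c ^+ 2 * rip ((g \o T) x) x.
  rewrite /= -sqr_rn (ripC _ x) /rip -Tg -/(rip _ _) -sqr_rn -exprMn.
  by rewrite ler_pXn2r ?nnegrE ?mulr_ge0 ?rn_ge0// ltW.
have [S sS _] := sqrt_fun_exists lA sA c0 bA.
have eA : (op_comp (adjoint T) T : H -> H) = g \o T.
  by apply/funext => x; exact: eTa.
(* Since the root [S] exists, [xget] returns a root and not its default value. *)
have [dS sqS] : dom (op_abs T) = setT /\ sqrt_fun (g \o T) (op_abs T).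
  rewrite -eA; apply/is_sqrtP => //; rewrite /op_abs /op_sqrt.
  apply: (@xgetPex _ _ [set S | is_sqrt _ S]).
  by exists (Operator setT S); apply/is_sqrtP => //; rewrite eA.
by split=> // S' sS'; exact: (sqrt_fun_unique lA sA c0 bA).
Qed.

End AbsoluteValue.

(** * Direct sums *)

(** Orthogonality to the null space and to the range of the sum is checked componentwise, so the
    pair of inverses satisfies [mp_rel], which determines the Moore-Penrose inverse. *)
Lemma moore_penrose_op_sum (R : realType) (H1 H2 K1 K2 : hilbertType R)
    (T1 : operator H1 K1) (T2 : operator H2 K2) :
  closed_op T1 -> closed_op T2 -> closed (ran T1) -> closed (ran T2) ->
  moore_penrose (op_sum T1 T2) =op op_sum (moore_penrose T1) (moore_penrose T2).
Proof.
move=> cT1 cT2 rT1 rT2.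
have [[d1 dl1 Tl1] _] := cT1; have [[d2 dl2 Tl2] _] := cT2.
have lT : linear_op (op_sum T1 T2).
  split=> [//|a x y [? ?] [? ?]|a x y [? ?] [? ?] /=].
    by split; [exact: dl1|exact: dl2].
  by rewrite Tl1// Tl2.
have rel y : mp_rel (op_sum T1 T2) y
    ((moore_penrose T1 y.1, moore_penrose T2 y.2) : hsum H1 H2).
  have [[dx1 ox1] oy1] := mp_relP cT1 rT1 y.1.
  have [[dx2 ox2] oy2] := mp_relP cT2 rT2 y.2.
  split; [split; first by []|].
    move=> [n1 n2] [[/= dn1 dn2] [e1 e2]].
    by rewrite -[LHS]/('[_, _] + '[_, _]) /= ox1// ox2// addr0.
  move=> _ [[x1 x2] [/= dx1' dx2'] <-].
  by rewrite -[LHS]/('[_, _] + '[_, _]) /= oy1 ?oy2 ?addr0//;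
    [exists x2|exists x1].
split=> [|y _]; last by have [] := moore_penroseP lT (rel y).
apply/seteqP; split=> y _; first by split; rewrite dom_moore_penrose.
by have [] := moore_penroseP lT (rel y).
Qed.

Theorem theorem3p7 (R : realType) (H1 H2 K1 K2 : hilbertType R)
    (T1 : operator H1 K1) (T2 : operator H2 K2)
    (dT1 : densely_defined T1) (dT2 : densely_defined T2)
    (cT1 : closed_op T1) (cT2 : closed_op T2)
    (rT1 : closed (ran T1)) (rT2 : closed (ran T2)) :
  op_abs (moore_penrose (op_sum T1 T2)) =op
    op_sum (op_abs (moore_penrose T1)) (op_abs (moore_penrose T2)).
Proof.
have [g1 adj1 [c1 c10 bd1]] :=
  everywhere_adjoint (@orthocomp_adjoint_dom_mp _ _ _ _ cT1 rT1).
have [g2 adj2 [c2 c20 bd2]] :=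
  everywhere_adjoint (@orthocomp_adjoint_dom_mp _ _ _ _ cT2 rT2).
have [dS1 [lS1 sS1 pS1 SS1] _] := op_absP (dom_moore_penrose cT1 rT1)
  (moore_penrose_linear cT1 rT1) adj1 c10 bd1.
have [dS2 [lS2 sS2 pS2 SS2] _] := op_absP (dom_moore_penrose cT2 rT2)
  (moore_penrose_linear cT2 rT2) adj2 c20 bd2.
have [dM eM] := moore_penrose_op_sum cT1 cT2 rT1 rT2.
have dMT : dom (moore_penrose (op_sum T1 T2)) = setT.
  by rewrite dM; apply/seteqP; split=> // y _; split; rewrite dom_moore_penrose.
have {}eM y : moore_penrose (op_sum T1 T2) y =
    (moore_penrose T1 y.1, moore_penrose T2 y.2) :> hsum H1 H2.
  by apply: eM; rewrite dMT.
pose g (z : hsum H1 H2) : hsum K1 K2 := (g1 z.1, g2 z.2).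
have adj x y : '[moore_penrose (op_sum T1 T2) x, y] = '[x, g y].
  rewrite eM -[LHS]/('[_, _] + '[_, _]) -[RHS]/('[_, _] + '[_, _]) /=.
  by rewrite -adj1 -adj2.
(* The sum [c1 + c2] serves as a common upper bound of [c1] and [c2]. *)
have bd z : rn (g z) <= (c1 + c2) * rn z.
  apply: rn_le; first by rewrite mulr_ge0 ?rn_ge0// ltW// addr_gt0.
  rewrite exprMn sqr_rn !rip_hsum /= mulrDr -!sqr_rn -!exprMn.
  have le_sq (k c x : R) : 0 <= k -> 0 <= x -> k <= c * x -> c <= c1 + c2 ->
      k ^+ 2 <= ((c1 + c2) * x) ^+ 2.
    move=> k0 x0 kcx cc; have {}kcx : k <= (c1 + c2) * x.
      by rewrite (le_trans kcx)// ler_wpM2r.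
    by rewrite lerXn2r// nnegrE (le_trans k0).
  by apply: lerD; [apply: le_sq (bd1 _) _|apply: le_sq (bd2 _) _];
    rewrite ?rn_ge0// ?lerDl ?lerDr ltW.
have lM : linear (moore_penrose (op_sum T1 T2)).
  move=> a x y; rewrite !eM.
  exact: (congr2 pair (moore_penrose_linear cT1 rT1 a x.1 y.1)
                      (moore_penrose_linear cT2 rT2 a x.2 y.2)).
have [dS sS uS] := op_absP dMT lM adj (addr_gt0 c10 c20) bd.
split; first by rewrite dS /= dS1 dS2; apply/seteqP.
(* By uniqueness it remains to check that the direct sum of the two absolute values is a positive
   symmetric root of [g] composed with the Moore-Penrose inverse of the sum. *)
move=> x _; apply/esym; move: x; apply: uS; split.
- by move=> a x y; exact: (congr2 pair (lS1 a x.1 y.1) (lS2 a x.2 y.2)).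
- move=> x y; rewrite -[LHS]/('[_, _] + '[_, _]) -[RHS]/('[_, _] + '[_, _]) /=.
  by rewrite sS1 sS2.
- by move=> x; rewrite rip_hsum addr_ge0//; [exact: pS1|exact: pS2].
- by move=> x; rewrite [RHS]/comp eM; exact: (congr2 pair (SS1 x.1) (SS2 x.2)).
Qed.
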